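(* Let $a=(\Sigma,\vdash)$ and $a'=(\Sigma',\vdash')$ be algebraizable logics and let $\mathbb{G}=(h:a\to a',\bar\rho)$ be a Glivenko's context, with lifting $\rho_X:F(\Sigma')(X)\to F(\Sigma)(X)$ of $\bar\rho_X$. Then for every $\Gamma'\cup\{\varphi'\}\subseteq F(\Sigma')(X)$, $$\rho_X[\Gamma']\vdash\rho_X(\varphi')\iff\Gamma'\vdash'\varphi'.$$
   Context: **Logics.** A signature is a sequence $\Sigma=(\Sigma_n)_{n\in\mathbb{N}}$ of pairwise disjoint sets ($\Sigma_n$: the $n$-ary connectives). $X=\{x_0,x_1,\dots\}$ is a fixed countable set of variables, $F(\Sigma)=F(\Sigma)(X)$ is the absolutely free $\Sigma$-algebra (set of formulas) on $X$, and $F(\Sigma)[n]$ is the set of formulas whose variables are exactly $x_0,\dots,x_{n-1}$. A logic is a pair $a=(\Sigma,\vdash)$ with $\vdash\subseteq\mathcal P(F(\Sigma))\times F(\Sigma)$ a reflexive, monotone, finitary, structural (substitution-invariant) relation satisfying cut. A flexible morphism $f:\Sigma\to\Sigma'$ is a family of functions $\Sigma_n\to F(\Sigma')[n]$; it extends to $\check f:F(\Sigma)\to F(\Sigma')$ by $\check f(x)=x$ for $x\in X$ and $\check f(c_n(\psi_0,\dots,\psi_{n-1}))=f(c_n)[x_0|\check f(\psi_0),\dots,x_{n-1}|\check f(\psi_{n-1})]$. A flexible translation $f:(\Sigma,\vdash)\to(\Sigma',\vdash')$ is a flexible morphism such that $\Gamma\vdash\psi$ implies $\check f[\Gamma]\vdash'\check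 f(\psi)$. **Algebraizable logics** (Blok–Pigozzi). For a class $K$ of $\Sigma$-algebras, $\models_K$ is the equational consequence of $K$. A logic $a=(\Sigma,\vdash)$ is algebraizable if there are a class $K$, a finite set $\tau(p)=\{(\varepsilon^j(p),\delta^j(p))\}_{j}$ of equations in one variable and a finite set $\Delta(p,q)$ of formulas in two variables such that $\Gamma\vdash\varphi$ iff $\bigcup_{\gamma\in\Gamma}\tau(\gamma)\models_K\tau(\varphi)$, and $\varphi\equiv\psi$ is interderivable under $\models_K$ with $\tau(\varphi\Delta\psi)$. Then $(\tau,\Delta)$ is an algebraizing pair, and there is a unique quasivariety $QV(a)$ that can serve as $K$. $\varphi/\Delta=[\varphi]=\{\psi:\ \vdash\varphi\Delta\psi\}$ (independent of the choice of $\Delta$); $F(\Sigma)/\Delta$ is the free $QV(a)$-algebra on $X$. $\mathcal A_f$ is the category of algebraizable logics and flexible translations preserving algebraizing pairs, i.e. sending an algebraizing pair $(\tau,\Delta)$ of the source to an algebraizing pair $(\check f(\tau),\check f(\Delta))$ of the target. **Functors on algebras.** For $h:a\to a'$ in $\mathcal A_f$ and a $\Sigma'$-algebra $M$, $h^\star(M)$ is the $\Sigma$-algebra on the same set with $c_n^{h^\star(M)}=h(c_n)^M$, and $h^\star$ is the identity on maps. It restricts to $h^\star{\restriction}:QV(a')\to QV(a)$, which has a left adjoint, written $L_h:QV(a)\to QV(a')$, with unit $\bar\partial:Id\Rightarrow h^\star{\restriction}\circ L_h$. One identifies $L_h(F(\Sigma)/\Delta)$ with $F(\Sigma')/\Delta'$,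 so that the unit at $F(\Sigma)/\Delta$ is $\bar\partial_X:F(\Sigma)/\Delta\to h^\star(F(\Sigma')/\Delta')$, $[\theta]\mapsto[\check h(\theta)]$. **Glivenko's context.** A pair $\mathbb{G}=(h:a\to a',\bar\rho)$ with $h\in\mathcal A_f(a,a')$ and $\bar\rho:h^\star{\restriction}\circ L_h\Rightarrow Id$ a natural transformation (of endofunctors of $QV(a)$) which is a section of the unit: $\bar\partial_M\circ\bar\rho_M=id$ for all $M\in QV(a)$. Write $\bar\rho_X:h^\star(F(\Sigma')/\Delta')\to F(\Sigma)/\Delta$ for its component at $F(\Sigma)/\Delta$. A lifting $\rho_X:F(\Sigma')(X)\to F(\Sigma)(X)$ of $\bar\rho_X$ is any (chosen) function with $[\rho_X(\theta')]=\bar\rho_X([\theta'])$ for all $\theta'\in F(\Sigma')(X)$. *)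

(* Defs.v *)
From mathcomp Require Import all_boot.
From mathcomp Require Import boolp classical_sets functions cardinality.

Set Implicit Arguments.
Unset Strict Implicit.
Unset Printing Implicit Defensive.

Local Open Scope classical_set_scope.

Record category := Category {
  obj :> Type;
  hom : obj -> obj -> Type;
  idm : forall A, hom A A;
  cmp : forall A B C, hom B C -> hom A B -> hom A C;
  cmp1m : forall A B (f : hom A B), cmp (idm B) f = f;
  cmpm1 : forall A B (f : hom A B), cmp f (idm A) = f;
  cmpA : forall A B C D (f : hom C D) (g : hom B C) (k : hom A B),
    cmp f (cmp g k) = cmp (cmp f g) k }.
Arguments idm {c} A.
Arguments cmp {c A B C} _ _.

Record functor (C D : category) := Functor {
  fobj :> C -> D;
  fmap : forall A B, hom A B -> hom (fobj A) (fobj B);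
  fmap1 : forall A, fmap (idm A) = idm (fobj A);
  fmapM : forall A B E (f : hom B E) (g : hom A B),
    fmap (cmp f g) = cmp (fmap f) (fmap g) }.
Arguments fmap {C D} _ {A B} _.

Definition functor_id (C : category) : functor C C :=
  @Functor C C (fun A => A) (fun A B f => f)
    (fun A => erefl) (fun A B E f g => erefl).

Section FunctorComp.
Variables (C D E : category) (G : functor D E) (F : functor C D).

Fact functor_comp_map1 A : fmap G (fmap F (idm A)) = idm (G (F A)).
Proof. by rewrite !fmap1. Qed.

Fact functor_comp_mapM A B A' (f : hom B A') (g : hom A B) :
  fmap G (fmap F (cmp f g)) = cmp (fmap G (fmap F f)) (fmap G (fmap F g)).
Proof. by rewrite !fmapM. Qed.

Definition functor_comp : functor C E :=
  @Functor C E (fun A => G (F A)) (fun A B f => fmap G (fmap F f))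
    functor_comp_map1 functor_comp_mapM.
End FunctorComp.

Record nat_trans (C D : category) (F G : functor C D) := NatTrans {
  component :> forall A : C, hom (F A) (G A);
  naturality : forall A B (f : hom A B),
    cmp (component B) (fmap F f) = cmp (fmap G f) (component A) }.

(* A left adjoint of [G], presented by its unit and the universal property of
   the latter. *)
Record left_adjoint (C D : category) (G : functor D C) := LeftAdjoint {
  ladj :> functor C D;
  unit : nat_trans (functor_id C) (functor_comp G ladj);
  unit_universal : forall (A : C) (B : D) (g : hom A (G B)),
    exists! k : hom (ladj A) B, cmp (fmap G k) (unit A) = g }.

Record iso (C : category) (A B : C) := Iso {
  iso_to : hom A B;
  iso_inv : hom B A;
  iso_toK : cmp iso_inv iso_to = idm A;
  iso_invK : cmp iso_to iso_inv = idm B }.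

(* [S n] is the set of n-ary connectives; pairwise disjointness is built in. *)
Definition signature := nat -> Type.

Inductive formula (S : signature) : Type :=
| Var of nat
| App n (c : S n) (args : 'I_n -> formula S).
Arguments Var {S} _.
Arguments App {S n} _ _.

Fixpoint vars S (phi : formula S) : set nat :=
  match phi with
  | Var i => [set i]
  | App n c args => [set i | exists k, vars (args k) i]
  end.

Fixpoint subst S (s : nat -> formula S) (phi : formula S) : formula S :=
  match phi with
  | Var i => s i
  | App n c args => App c (fun k => subst s (args k))
  end.

(* The assignment sending [i < n] to [args i], and [i >= n] to [d i]. *)
Definition extend T (d : nat -> T) n (args : 'I_n -> T) (i : nat) : T :=
  if insub i is Some k then args k else d i.

Record logic := Logic {
  sig :> signature;
  entails : set (formula sig) -> formula sig -> Prop;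
  entails_refl : forall Gamma phi, Gamma phi -> entails Gamma phi;
  entails_mono : forall Gamma Gamma' phi,
    Gamma `<=` Gamma' -> entails Gamma phi -> entails Gamma' phi;
  entails_cut : forall Gamma Theta phi,
    (forall theta, Theta theta -> entails Gamma theta) ->
    entails Theta phi -> entails Gamma phi;
  entails_fin : forall Gamma phi, entails Gamma phi ->
    exists Gamma0, [/\ Gamma0 `<=` Gamma, finite_set Gamma0
                     & entails Gamma0 phi];
  entails_struct : forall (s : nat -> formula sig) Gamma phi,
    entails Gamma phi -> entails (subst s @` Gamma) (subst s phi) }.

Notation "Gamma ⊢[ a ] phi" := (@entails a Gamma phi)
  (at level 70, format "Gamma  ⊢[ a ]  phi", no associativity).

Record flex_mor (S S' : signature) := FlexMor {
  flex_fun : forall n, S n -> formula S';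
  flex_vars : forall n (c : S n), vars (flex_fun c) = `I_n }.
Arguments flex_fun {S S'} _ {n} _.

Fixpoint flex_ext S S' (h : flex_mor S S') (phi : formula S) : formula S' :=
  match phi with
  | Var i => Var i
  | App n c args =>
      subst (extend Var (fun k => flex_ext h (args k))) (flex_fun h c)
  end.

Definition is_translation (a a' : logic) (h : flex_mor a a') : Prop :=
  forall Gamma psi, Gamma ⊢[a] psi -> flex_ext h @` Gamma ⊢[a'] flex_ext h psi.

(* As usual in universal algebra, carriers are nonempty. *)
Record algebra (S : signature) := Algebra {
  carrier :> Type;
  op : forall n, S n -> ('I_n -> carrier) -> carrier;
  carrier_inhabited : inhabited carrier }.
Arguments op {S} _ {n} _ _.

Record alg_hom (S : signature) (M N : algebra S) := AlgHom {
  alg_fun :> M -> N;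
  alg_funE : forall n (c : S n) (args : 'I_n -> M),
    alg_fun (op M c args) = op N c (fun k => alg_fun (args k)) }.

Definition alg_class (S : signature) := algebra S -> Prop.

Fixpoint eval S (M : algebra S) (v : nat -> M) (phi : formula S) : M :=
  match phi with
  | Var i => v i
  | App n c args => op M c (fun k => eval v (args k))
  end.

Definition equation S := (formula S * formula S)%type.

Definition holds S (M : algebra S) (v : nat -> M) (e : equation S) : Prop :=
  eval v e.1 = eval v e.2.

Definition eq_conseq S (K : alg_class S) (E F : set (equation S)) : Prop :=
  forall M, K M -> forall v : nat -> M,
    (forall e, E e -> holds v e) -> forall f, F f -> holds v f.

(* A class of algebras axiomatized by quasi-identities, i.e. by implications
   from a finite set of equations to an equation. *)
Definition quasivariety S (K : alg_class S) : Prop :=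
  exists Q : set (set (equation S) * equation S),
    (forall q, Q q -> finite_set q.1) /\
    (forall M, K M <-> forall q, Q q -> forall v : nat -> M,
        (forall e, q.1 e -> holds v e) -> holds v q.2).

(* The variable [p] is [Var 0] and [q] is [Var 1]. *)
Record alg_pair (S : signature) := AlgPair {
  tau : set (equation S);
  Delta : set (formula S) }.

Definition subst1 S (phi : formula S) := subst (fun _ => phi).

Definition subst2 S (phi psi : formula S) :=
  subst (fun i => if i is 0 then phi else psi).

Definition tau_at S (P : alg_pair S) (phi : formula S) : set (equation S) :=
  (fun e => (subst1 phi e.1, subst1 phi e.2)) @` tau P.

Definition Delta_at S (P : alg_pair S) (phi psi : formula S)
  : set (formula S) := subst2 phi psi @` Delta P.

Record algebraizes (a : logic) (K : alg_class a) (P : alg_pair a) : Prop := {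
  tau_finite : finite_set (tau P);
  tau_vars : forall e, tau P e -> vars e.1 `<=` `I_1 /\ vars e.2 `<=` `I_1;
  Delta_finite : finite_set (Delta P);
  Delta_vars : forall d, Delta P d -> vars d `<=` `I_2;
  tau_complete : forall Gamma phi,
    Gamma ⊢[a] phi <->
    eq_conseq K (\bigcup_(gamma in Gamma) tau_at P gamma) (tau_at P phi);
  tau_Delta : forall phi psi,
    eq_conseq K [set (phi, psi)]
      (\bigcup_(d in Delta_at P phi psi) tau_at P d) /\
    eq_conseq K (\bigcup_(d in Delta_at P phi psi) tau_at P d)
      [set (phi, psi)] }.

Definition algebraizing_pair (a : logic) (P : alg_pair a) : Prop :=
  exists K, algebraizes K P.

Definition algebraizable (a : logic) : Prop :=
  exists P, algebraizing_pair (a := a) P.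

Record alg_logic := AlgLogic {
  al_logic :> logic;
  al_algebraizable : algebraizable al_logic }.

(* The union of all quasivarieties that can serve as [K]; there is exactly one,
   by [QV_exists_unique]. *)
Definition QV (a : logic) : alg_class a := fun M =>
  exists K : alg_class a,
    [/\ quasivariety K, exists P, algebraizes K P & K M].

Definition pair_image S S' (h : flex_mor S S') (P : alg_pair S) :
    alg_pair S' :=
  AlgPair ((fun e => (flex_ext h e.1, flex_ext h e.2)) @` tau P)
          (flex_ext h @` Delta P).

Record Af_hom (a a' : alg_logic) := AfHom {
  af_mor :> flex_mor a a';
  af_translation : is_translation af_mor;
  af_pairs : forall P, algebraizing_pair P ->
    algebraizing_pair (a := a') (pair_image af_mor P) }.

Section Syntax.
Variable S : signature.

Lemma eq_subst_vars (s t : nat -> formula S) (phi : formula S) :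
  (forall i, vars phi i -> s i = t i) -> subst s phi = subst t phi.
Proof.
elim: phi => [i|n c args IH] /= st; first exact: st.
by congr App; apply: funext => k; apply: IH => i ik; apply: st; exists k.
Qed.

Lemma eq_eval_vars (M : algebra S) (v w : nat -> M) (phi : formula S) :
  (forall i, vars phi i -> v i = w i) -> eval v phi = eval w phi.
Proof.
elim: phi => [i|n c args IH] /= st; first exact: st.
by congr op; apply: funext => k; apply: IH => i ik; apply: st; exists k.
Qed.

Lemma subst_subst (s t : nat -> formula S) (phi : formula S) :
  subst s (subst t phi) = subst (fun i => subst s (t i)) phi.
Proof.
elim: phi => [//|n c args IH] /=.
by congr App; apply: funext => k; apply: IH.
Qed.

Lemma eval_subst (M : algebra S) (v : nat -> M) s (phi : formula S) :
  eval v (subst s phi) = eval (fun i => eval v (s i)) phi.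
Proof.
elim: phi => [//|n c args IH] /=.
by congr op; apply: funext => k; apply: IH.
Qed.

Lemma eval_alg_hom (M N : algebra S) (f : alg_hom M N) (v : nat -> M)
    (phi : formula S) :
  f (eval v phi) = eval (fun i => f (v i)) phi.
Proof.
elim: phi => [//|n c args IH] /=.
by rewrite alg_funE; congr op; apply: funext => k; apply: IH.
Qed.

End Syntax.

Lemma extendE T (d : nat -> T) n (args : 'I_n -> T) (k : 'I_n) :
  extend d args k = args k.
Proof. by rewrite /extend valK. Qed.

Lemma extend_lt T U (f : T -> U) (d : nat -> T) (d' : nat -> U) n
    (args : 'I_n -> T) i :
  (i < n)%N -> f (extend d args i) = extend d' (fun k => f (args k)) i.
Proof. by move=> ltin; rewrite -[i]/(val (Ordinal ltin)) !extendE. Qed.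

Section FlexSyntax.
Variables S S' : signature.

Lemma flex_ext_subst (h : flex_mor S S') s (phi : formula S) :
  flex_ext h (subst s phi) = subst (fun i => flex_ext h (s i)) (flex_ext h phi).
Proof.
elim: phi => [//|n c args IH] /=.
rewrite subst_subst; apply: eq_subst_vars => i; rewrite flex_vars /= => ltin.
rewrite (extend_lt _ _ Var) //; congr extend.
by apply: funext => k; apply: IH.
Qed.

Lemma flex_tau_at (h : flex_mor S S') P phi :
  tau_at (pair_image h P) (flex_ext h phi) =
  (fun e => (flex_ext h e.1, flex_ext h e.2)) @` tau_at P phi.
Proof.
rewrite /tau_at /= !image_comp; congr (_ @` _).
by apply: funext => e /=; rewrite /subst1 !flex_ext_subst.
Qed.

Lemma flex_Delta_at (h : flex_mor S S') P phi psi :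
  Delta_at (pair_image h P) (flex_ext h phi) (flex_ext h psi) =
  flex_ext h @` Delta_at P phi psi.
Proof.
rewrite /Delta_at /= !image_comp; congr (_ @` _).
apply: funext => d /=; rewrite /subst2 flex_ext_subst //.
by apply: eq_subst_vars => -[].
Qed.

End FlexSyntax.

Section EquationalConsequence.
Variable a : logic.
Implicit Types (K : alg_class a) (P : alg_pair a) (phi psi : formula a).

Lemma holds_Delta K P : algebraizes K P ->
  forall M, K M -> forall (v : nat -> M) phi psi,
  holds v (phi, psi) <->
  (forall d, Delta_at P phi psi d -> forall e, tau_at P d e -> holds v e).
Proof.
move=> KP M KM v phi psi; have [c1 c2] := tau_Delta KP phi psi; split.
  by move=> pp d dD e ed; apply: (c1 M KM v) => [_ ->//|]; exists d.
by move=> H; apply: (c2 M KM v) => // e [d dD ed]; exact: H ed.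
Qed.

Lemma Delta_refl K P : algebraizes K P ->
  forall phi d, Delta_at P phi phi d -> set0 ⊢[a] d.
Proof.
move=> KP phi d dD; apply/(tau_complete KP) => M KM v _ e ed.
exact: (holds_Delta KP KM v phi phi).1 _ dD _ ed.
Qed.

Lemma Delta_interderivable K P K' P' : algebraizes K P -> algebraizes K' P' ->
  forall phi psi d, Delta_at P phi psi d -> Delta_at P' phi psi ⊢[a] d.
Proof.
move=> KP KP' phi psi _ [d dD <-].
apply/(tau_complete KP') => M KM v Hv _ [e eP <-].
have pp : holds v (phi, psi).
  by apply/(holds_Delta KP' KM) => d' dD' e' ed'; apply: Hv; exists d'.
have /(tau_complete KP') T : set0 ⊢[a] subst2 phi phi d.
  by apply: (Delta_refl KP); exists d.
have: holds v (subst1 (subst2 phi phi d) e.1, subst1 (subst2 phi phi d) e.2).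
  by apply: (T M KM v) => [? []//|]; exists e.
have E : eval v (subst2 phi phi d) = eval v (subst2 phi psi d).
  rewrite /subst2 !eval_subst; congr (eval _ d).
  by apply: funext => -[].
have E1 x : eval v (subst1 (subst2 phi phi d) x) =
            eval v (subst1 (subst2 phi psi d) x).
  by rewrite /subst1 [LHS]eval_subst [RHS]eval_subst E.
by rewrite /holds /= !E1.
Qed.

Definition Delta_set P (E : set (equation a)) : set (formula a) :=
  \bigcup_(e in E) Delta_at P e.1 e.2.

Lemma eq_conseqE K P : algebraizes K P -> forall E phi psi,
  eq_conseq K E [set (phi, psi)] <->
  forall d, Delta_at P phi psi d -> Delta_set P E ⊢[a] d.
Proof.
move=> KP E phi psi; split.
  move=> H d dD; apply/(tau_complete KP) => M KM v Hv.
  apply: (holds_Delta KP KM v phi psi).1 dD; apply: (H M KM v) => // -[s t] est.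
  apply/(holds_Delta KP KM) => d' dD' e ed'; apply: Hv.
  by exists d' => //; exists (s, t).
move=> H M KM v Hv _ ->; apply/(holds_Delta KP KM) => d dD.
apply: ((tau_complete KP _ _).1 (H d dD) M KM v) => e [d' [[s t] est dD'] ed'].
by apply: (holds_Delta KP KM v s t).1 dD' _ ed'; exact: Hv.
Qed.

Lemma eq_conseq_indep K P K' P' E F : algebraizes K P -> algebraizes K' P' ->
  eq_conseq K E F -> eq_conseq K' E F.
Proof.
move=> KP KP' H M KM v Hv [phi psi] Ff.
suff: eq_conseq K' E [set (phi, psi)] by exact.
have /(eq_conseqE KP) D : eq_conseq K E [set (phi, psi)].
  by move=> N KN w Hw _ ->; exact: H Hw _ Ff.
apply/(eq_conseqE KP') => d' dD'.
apply: (entails_cut _ (Delta_interderivable KP' KP dD')) => d dD.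
apply: (entails_cut _ (D d dD)) => {dD}d [[s t] est dD].
apply: (entails_mono _ (Delta_interderivable KP KP' dD)) => x xD.
by exists (s, t).
Qed.

Lemma quasivariety_generated K P : algebraizes K P ->
  exists2 Q : alg_class a, quasivariety Q & algebraizes Q P.
Proof.
move=> KP.
pose Q : alg_class a := fun M => forall E e,
  finite_set E -> eq_conseq K E [set e] ->
  forall v : nat -> M, (forall x, E x -> holds v x) -> holds v e.
have KQ M : K M -> Q M by move=> KM E e _ H v Hv; exact: (H M KM v).
have QK E F : eq_conseq Q E F -> eq_conseq K E F.
  by move=> H M KM; apply: H; exact: KQ.
have fQ E F : finite_set E -> eq_conseq K E F -> eq_conseq Q E F.
  move=> fE H M QM v Hv f Ff; apply: (QM E) => // N KN w Hw _ ->.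
  exact: (H N KN w).
have ftau G : finite_set G -> finite_set (\bigcup_(g in G) tau_at P g).
  move=> fG; apply: bigcup_finite => // g _.
  exact/finite_image/(tau_finite KP).
exists Q.
  exists [set q | finite_set q.1 /\ eq_conseq K q.1 [set q.2]].
  split=> [q []//|M]; split=> [QM [E e] [/= fE H]|H E e fE KE].
    exact: QM.
  exact: (H (E, e)).
split; [exact: tau_finite KP | exact: tau_vars KP | exact: Delta_finite KP
       | exact: Delta_vars KP | |].
  move=> G phi; split=> [|/QK /(tau_complete KP)//].
  move=> /entails_fin [G0 [sG0 fG0 /(tau_complete KP)/(fQ _ _ (ftau _ fG0))]].
  move=> H M QM v Hv; apply: (H M QM v) => e [g G0g eg]; apply: Hv.
  by exists g => //; exact: sG0.
move=> phi psi; have [c1 c2] := tau_Delta KP phi psi; split; apply: fQ => //.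
exact/ftau/finite_image/(Delta_finite KP).
Qed.

Lemma quasivariety_sub K P K' P' : algebraizes K P -> algebraizes K' P' ->
  quasivariety K' -> forall M, K M -> K' M.
Proof.
move=> KP KP' [Q [_ QK]] M KM; apply/QK => q Qq v Hv.
have : eq_conseq K' q.1 [set q.2].
  by move=> N /QK KN w Hw _ ->; exact: KN.
by move=> /(eq_conseq_indep KP' KP) H; apply: (H M KM v).
Qed.

Lemma QV_eq K P : quasivariety K -> algebraizes K P -> @QV a = K.
Proof.
move=> qK KP; apply: funext => M; apply/propeqP; split.
  by move=> [K' [_ [P' KP'] KM]]; exact: quasivariety_sub KP' KP qK _ KM.
by move=> KM; exists K; split=> //; exists P.
Qed.

Lemma QV_exists_unique : algebraizable a ->
  [/\ quasivariety (@QV a),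
      exists P, algebraizes (@QV a) P
    & forall K P, quasivariety K -> algebraizes K P -> K = @QV a].
Proof.
move=> [P [K /quasivariety_generated [Q qQ QP]]].
split=> [||K' P' qK KP]; last exact/esym/QV_eq/KP.
  by rewrite (QV_eq qQ QP).
by rewrite (QV_eq qQ QP); exists P.
Qed.

Lemma QV_quasivariety : algebraizable a -> quasivariety (@QV a).
Proof. by case/QV_exists_unique. Qed.

Lemma QV_algebraizes P : algebraizing_pair P -> algebraizes (@QV a) P.
Proof.
by move=> [K /quasivariety_generated [Q qQ QP]]; rewrite (QV_eq qQ QP).
Qed.

End EquationalConsequence.

Record QV_alg (a : logic) := QVAlg {
  qv_alg :> algebra a;
  qv_mem : QV qv_alg }.

Section QVCategory.
Variable a : logic.

Lemma alg_hom_eq (S : signature) (M N : algebra S) (f g : alg_hom M N) :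
  (forall x, f x = g x) -> f = g.
Proof.
case: f g => [f fE] [g gE] /= /funext fg; rewrite fg in fE *.
by congr AlgHom; exact: Prop_irrelevance.
Qed.

Definition alg_id (S : signature) (M : algebra S) : alg_hom M M :=
  @AlgHom S M M (fun x => x) (fun n c args => erefl).

Fact alg_comp_subproof (S : signature) (M N T : algebra S) (f : alg_hom N T)
    (g : alg_hom M N) n (c : S n) (args : 'I_n -> M) :
  f (g (op M c args)) = op T c (fun k => f (g (args k))).
Proof. by rewrite !alg_funE. Qed.

Definition alg_comp (S : signature) (M N T : algebra S) (f : alg_hom N T)
    (g : alg_hom M N) : alg_hom M T :=
  @AlgHom S M T (fun x => f (g x)) (alg_comp_subproof f g).

Fact alg_comp1m (M N : QV_alg a) (f : alg_hom M N) : alg_comp (alg_id N) f = f.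
Proof. exact: alg_hom_eq. Qed.

Fact alg_compm1 (M N : QV_alg a) (f : alg_hom M N) : alg_comp f (alg_id M) = f.
Proof. exact: alg_hom_eq. Qed.

Fact alg_compA (M N T U : QV_alg a) (f : alg_hom T U) (g : alg_hom N T)
    (k : alg_hom M N) :
  alg_comp f (alg_comp g k) = alg_comp (alg_comp f g) k.
Proof. exact: alg_hom_eq. Qed.

Definition QVcat : category :=
  @Category (QV_alg a) (fun M N => alg_hom M N) (fun M => alg_id M)
    (fun M N T f g => alg_comp f g) alg_comp1m alg_compm1 alg_compA.

End QVCategory.

Definition hom_fun (a : logic) (A B : QVcat a) (f : hom A B) :
    qv_alg A -> qv_alg B := alg_fun f.

Section FreeAlgebra.
Variables (a : logic) (P : alg_pair a).
Hypothesis aP : algebraizing_pair P.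

Definition Delta_class (phi : formula a) : set (formula a) :=
  [set psi | forall d, Delta_at P phi psi d -> set0 ⊢[a] d].

Definition free_carrier : Type :=
  {A : set (formula a) | exists phi, A = Delta_class phi}.

Definition cls (phi : formula a) : free_carrier :=
  exist _ (Delta_class phi) (ex_intro _ phi erefl).

Definition repr (x : free_carrier) : formula a := projT1 (cid (svalP x)).

Lemma reprK x : cls (repr x) = x.
Proof.
by rewrite /cls /repr; case: cid => phi /= E; case: x E => A p /= E; exact: eq_exist.
Qed.

(* Independent of the representatives by [free_opE]. *)
Definition free_op n (c : sig a n) (args : 'I_n -> free_carrier) : free_carrier :=
  cls (App c (fun k => repr (args k))).

Definition free_algebra : algebra a :=
  @Algebra a free_carrier free_op (inhabits (cls (Var 0))).

Lemma Delta_classE phi psi :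
  Delta_class phi psi <->
  forall M, QV M -> forall v : nat -> M, eval v phi = eval v psi.
Proof.
have QP := QV_algebraizes aP; split=> [H M QM v|H d dD].
  apply/(holds_Delta QP QM v phi psi) => d dD e ed.
  by apply: ((tau_complete QP _ _).1 (H d dD) M QM v) => // ? [].
apply/(tau_complete QP) => M QM v _ e ed.
by apply: (holds_Delta QP QM v phi psi).1 dD e ed; exact: H.
Qed.

Lemma cls_eq phi psi : cls phi = cls psi <->
  forall M, QV M -> forall v : nat -> M, eval v phi = eval v psi.
Proof.
split=> [/(congr1 sval) /= E|H].
  by apply/Delta_classE; rewrite E; apply/Delta_classE.
apply: eq_exist; apply/seteqP; split=> x /Delta_classE X; apply/Delta_classE.
  by move=> M QM v; rewrite -H // X.
by move=> M QM v; rewrite H // X.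
Qed.

Lemma free_opE n (c : sig a n) (args : 'I_n -> formula a) :
  op free_algebra c (fun k => cls (args k)) = cls (App c args).
Proof.
apply/cls_eq => M QM v /=; congr op; apply: funext => k.
by apply: (cls_eq _ _).1 QM v; rewrite reprK.
Qed.

Lemma eval_cls (s : nat -> formula a) phi :
  eval (M := free_algebra) (fun i => cls (s i)) phi = cls (subst s phi).
Proof.
elim: phi => [//|n c args IH] /=.
by rewrite -free_opE; congr free_op; apply: funext => k; apply: IH.
Qed.

Lemma free_algebra_QV : QV free_algebra.
Proof.
have [Q [_ QE]] := QV_quasivariety (ex_intro _ P aP).
apply/QE => q Qq v Hv.
have Ev phi : eval v phi = cls (subst (fun i => repr (v i)) phi).
  by rewrite -eval_cls; congr eval; apply: funext => i; rewrite reprK.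
rewrite /holds !Ev; apply/cls_eq => M QM w; rewrite !eval_subst.
apply: ((QE M).1 QM q Qq) => e /Hv; rewrite /holds !Ev => /cls_eq H.
by rewrite -!eval_subst; exact: H.
Qed.

Definition free_QV : QVcat a := QVAlg free_algebra_QV.

End FreeAlgebra.

Section Star.
Variables (a a' : alg_logic) (h : Af_hom a a').

Definition point S (M : algebra S) : M :=
  projT1 (cid (let: inhabits x := carrier_inhabited M in ex_intro _ x I)).

(* Only the values of the assignment on [i < n] matter, since the variables of
   [h c] are those. *)
Definition star_op (M : algebra a') n (c : sig a n) (args : 'I_n -> M) : M :=
  eval (extend (fun _ => point M) args) (flex_fun h c).

Definition star_alg (M : algebra a') : algebra a :=
  @Algebra a M (@star_op M) (carrier_inhabited M).

Lemma eval_star (M : algebra a') (v : nat -> M) phi :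
  eval (M := star_alg M) v phi = eval v (flex_ext h phi).
Proof.
elim: phi => [//|n c args IH] /=.
rewrite eval_subst; apply: eq_eval_vars => i; rewrite flex_vars /= => ltin.
rewrite (extend_lt _ _ (fun _ => point M)) //; congr extend.
by apply: funext => k; apply: IH.
Qed.

Lemma star_QV (M : algebra a') : QV M -> QV (star_alg M).
Proof.
move=> QM; have [P aP] := al_algebraizable a.
have QP := QV_algebraizes aP.
have QP' := QV_algebraizes (af_pairs h aP).
have [Q [_ QE]] := QV_quasivariety (al_algebraizable a).
apply/QE => -[E [phi psi]] Qq v /= Hv; rewrite /holds /= !eval_star.
have /(eq_conseqE QP) H : eq_conseq (@QV a) E [set (phi, psi)].
  by move=> N /QE QN w Hw _ ->; exact: (QN _ Qq).
apply/(holds_Delta QP' QM v (flex_ext h phi) (flex_ext h psi)) => d.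
rewrite flex_Delta_at => -[{}d dD <-] e ed.
have /(tau_complete QP') {}H := af_translation h (H d dD).
apply: (H M QM v) => // f [_ [g [[s t] est gD] <-] fg].
have: @holds a' M v (flex_ext h s, flex_ext h t).
  by have := Hv _ est; rewrite /holds /= !eval_star.
move=> /(holds_Delta QP' QM v (flex_ext h s) (flex_ext h t)); apply; last exact: fg.
by rewrite flex_Delta_at; exists g.
Qed.

Definition star_obj (M : QVcat a') : QVcat a := QVAlg (star_QV (qv_mem M)).

Fact star_hom_subproof (M N : algebra a') (f : alg_hom M N)
    n (c : sig a n) (args : 'I_n -> M) :
  f (star_op c args) = star_op c (fun k => f (args k)).
Proof.
rewrite /star_op eval_alg_hom; apply: eq_eval_vars => i.
by rewrite flex_vars /= => ltin; rewrite (extend_lt _ _ (fun _ => point N)).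
Qed.

Definition star_hom (M N : algebra a') (f : alg_hom M N) :
    alg_hom (star_alg M) (star_alg N) :=
  @AlgHom a (star_alg M) (star_alg N) f (star_hom_subproof f).

Fact star_hom1 (M : QVcat a') :
  star_hom (idm M) = idm (star_obj M).
Proof. exact: alg_hom_eq. Qed.

Fact star_homM (M N T : QVcat a') (f : hom N T) (g : hom M N) :
  star_hom (cmp f g) =
  @cmp (QVcat a) (star_obj M) (star_obj N) (star_obj T) (star_hom f) (star_hom g).
Proof. exact: alg_hom_eq. Qed.

Definition star : functor (QVcat a') (QVcat a) :=
  @Functor (QVcat a') (QVcat a) star_obj (fun M N f => star_hom f)
    star_hom1 star_homM.

End Star.

Record glivenko_context (a a' : alg_logic) (h : Af_hom a a')
    (L : left_adjoint (star h)) := GlivenkoContext {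
  rho_bar :> nat_trans (functor_comp (star h) L) (functor_id (QVcat a));
  rho_bar_section : forall M : QVcat a,
    cmp (unit L M) (rho_bar M) = idm (star h (L M)) }.

(* [F(S)/Delta] and [F(S')/Delta'] are formed with arbitrary algebraizing pairs
   [P] and [P']; they do not depend on the choice. *)
Section Identification.
Variables (a a' : alg_logic) (h : Af_hom a a') (L : left_adjoint (star h)).
Variables (P : alg_pair a) (aP : algebraizing_pair P).
Variables (P' : alg_pair a') (aP' : algebraizing_pair P').

(* The identification of [L (F(S)/Delta)] with [F(S')/Delta'], under which the
   unit at [F(S)/Delta] maps the class of [theta] to that of [h theta]. *)
Record free_identification := FreeIdentification {
  free_iso :> iso (L (free_QV aP)) (free_QV aP');
  free_iso_unit : forall theta : formula a,
    hom_fun (iso_to free_iso) (hom_fun (unit L (free_QV aP)) (cls P theta)) =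
    cls P' (flex_ext h theta) }.

Lemma free_identification_exists : inhabited free_identification.
Proof.
pose F := free_QV aP; pose F' := free_QV aP'.
pose canf (x : F) : F' := cls P' (flex_ext h (repr x)).
have canE theta : canf (cls P theta) = cls P' (flex_ext h theta).
  apply/(cls_eq aP') => M QM v; rewrite -!eval_star.
  have /(cls_eq aP) H : cls P (repr (cls P theta)) = cls P theta by rewrite reprK.
  by apply: (H (star_alg h M)); exact: star_QV.
have canM n (c : sig a n) (args : 'I_n -> F) :
    canf (op F c args) = op (star_alg h F') c (fun k => canf (args k)).
  rewrite [op F c args]/(cls P _) canE /= /star_op.
  rewrite -(eval_cls aP'); apply: (@eq_eval_vars _ (free_algebra P')) => i; rewrite flex_vars /= => ltin.
  by rewrite (extend_lt (cls P') Var (fun _ => point F')).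
pose can : hom F (star h F') := @AlgHom a F (star_alg h F') canf canM.
have [k [kE _]] := @unit_universal _ _ _ L _ _ can.
have kcls theta :
    hom_fun k (hom_fun (unit L F) (cls P theta)) = cls P' (flex_ext h theta).
  by rewrite -canE; move: (congr1 (fun f => @hom_fun a F (star h F') f (cls P theta)) kE).
pose w i : qv_alg (L F) := hom_fun (unit L F) (cls P (Var i)).
pose jf (x : F') : qv_alg (L F) := eval w (repr x).
have jE theta : jf (cls P' theta) = eval w theta.
  have /(cls_eq aP') H : cls P' (repr (cls P' theta)) = cls P' theta.
    by rewrite reprK.
  by apply: (H (L F)); exact: qv_mem.
have jM n (c : sig a' n) (args : 'I_n -> F') :
    jf (op F' c args) = op (qv_alg (L F)) c (fun k => jf (args k)).
  by rewrite [op F' c args]/(cls P' _) jE.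
pose j : hom F' (L F) := @AlgHom a' F' (qv_alg (L F)) jf jM.
have clsE theta : eval (M := F) (fun i => cls P (Var i)) theta = cls P theta.
  rewrite (eval_cls aP); congr cls.
  by elim: theta => [//|n c args IH] /=; congr App; apply: funext.
have clsE' theta : eval (M := F') (fun i => cls P' (Var i)) theta = cls P' theta.
  rewrite (eval_cls aP'); congr cls.
  by elim: theta => [//|n c args IH] /=; congr App; apply: funext.
have jk : cmp j k = idm (L F).
  have [u [_ uE]] := @unit_universal _ _ _ L _ (L F) (unit L F).
  rewrite -(uE (cmp j k)); first rewrite -(uE (idm (L F))) //.
    by rewrite fmap1 cmp1m.
  apply: alg_hom_eq => x; rewrite -(reprK x); set theta := repr x.
  change (jf (hom_fun k (hom_fun (unit L F) (cls P theta))) =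
          hom_fun (unit L F) (cls P theta)).
  by rewrite kcls jE -(eval_star h) -clsE /hom_fun eval_alg_hom.
have kj : cmp k j = idm F'.
  apply: alg_hom_eq => x; rewrite -(reprK x); set theta := repr x.
  change (hom_fun k (jf (cls P' theta)) = cls P' theta).
  rewrite jE /hom_fun eval_alg_hom -clsE'; congr (eval _ theta).
  by apply: funext => i; exact: kcls.
by constructor; exists (Iso jk kj).
Qed.

Variables (G : glivenko_context L) (I : free_identification).

Definition rho_bar_X (x : free_carrier P') : free_carrier P :=
  hom_fun (rho_bar G (free_QV aP)) (hom_fun (iso_inv I) x).

Definition is_lifting (rho_X : formula a' -> formula a) : Prop :=
  forall theta', cls P (rho_X theta') = rho_bar_X (cls P' theta').

End Identification.

(* Main.v *)
(** For [M] in [QV(a)], the component [rho_M : h*(L M) -> M] is an injective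
    homomorphism, being a section of the unit. By naturality at the homomorphism
    [F(S)/Delta -> M] induced by an assignment [v], the value of [rho_X theta']
    under [v] is the image by [rho_M] of the value of [theta'] under an
    assignment [w] in [L M]. Since [rho_M] preserves and reflects equations,
    [v] satisfies [tau (rho_X theta')] iff [w] satisfies [h(tau)(theta')], and
    [h(tau)] belongs to an algebraizing pair of [a']: this transports
    derivations from [a'] to [a]. The converse holds since [h] is a translation
    and [h (rho_X theta')] is equivalent to [theta']. *)
Require Import Defs.
From mathcomp Require Import all_boot.
From mathcomp Require Import boolp classical_sets functions cardinality.

Local Open Scope classical_set_scope.

Lemma hom_fun_cmp (a : logic) (A B C : QVcat a) (f : hom B C) (g : hom A B) x :
  hom_fun (cmp f g) x = hom_fun f (hom_fun g x).
Proof. by []. Qed.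

Lemma eval_hom_fun (a : logic) (A B : QVcat a) (f : hom A B)
    (v : nat -> qv_alg A) phi :
  hom_fun f (eval v phi) = eval (fun i => hom_fun f (v i)) phi.
Proof. exact: eval_alg_hom. Qed.

Lemma subst_Var (S : signature) (phi : formula S) : subst Var phi = phi.
Proof. by elim: phi => [//|n c args IH] /=; congr App; apply: funext. Qed.

Lemma eval_cls_Var (a : logic) (P : alg_pair a) (phi : formula a) :
  algebraizing_pair P ->
  eval (M := free_algebra P) (fun i => cls P (Var i)) phi = cls P phi.
Proof. by move=> aP; rewrite (eval_cls aP) subst_Var. Qed.

(** Evaluating a chosen representative is well defined, since formulas of one class agree in every
    member of [QV]. *)
Lemma free_hom_exists {a : logic} {P : alg_pair a} (aP : algebraizing_pair P)
    (M : QVcat a) (v : nat -> qv_alg M) :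
  exists f : hom (free_QV aP) M, forall phi, hom_fun f (cls P phi) = eval v phi.
Proof.
pose f (x : free_carrier P) : qv_alg M := eval v (Defs.repr x).
have fE phi : f (cls P phi) = eval v phi.
  have /(cls_eq aP) E : cls P (Defs.repr (cls P phi)) = cls P phi by rewrite Defs.reprK.
  exact: E (qv_mem M) v.
have fM n (c : sig a n) (args : 'I_n -> free_algebra P) :
    f (op (free_algebra P) c args) = op (qv_alg M) c (fun k => f (args k)).
  by rewrite [op _ c args]/(cls P _) fE.
by exists (@AlgHom a (free_algebra P) (qv_alg M) f fM).
Qed.

(** The [tau]-equations of [s t] and [t] have the same solutions in [K], so [s] can be erased. To be
    used with [s] the composite of [rho_X] and [flex_ext h]. *)
Lemma holds_tau_transport (a : logic) (K : alg_class a) (P : alg_pair a)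
    (s : formula a -> formula a) (Gamma : set (formula a)) phi :
  algebraizes K P ->
  (forall M, K M -> forall (v : nat -> M) t, eval v (s t) = eval v t) ->
  s @` Gamma ⊢[a] s phi -> Gamma ⊢[a] phi.
Proof.
move=> KP sE /(tau_complete KP) H; apply/(tau_complete KP) => M KM v Hv.
have tauE t e : holds v (subst1 (s t) e.1, subst1 (s t) e.2) <->
    holds v (subst1 t e.1, subst1 t e.2).
  by rewrite /holds /= /subst1 !eval_subst sE.
move=> _ [e eP <-]; apply/tauE; apply: (H M KM v); last by exists e.
move=> _ [_ [t Gt <-] [d dP <-]]; apply/tauE.
by apply: Hv; exists t => //; exists d.
Qed.

Section GlivenkoContext.
Context {a a' : alg_logic} {h : Af_hom a a'} {L : left_adjoint (star h)}.
Variable G : glivenko_context L.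

Lemma rho_barK (M : QVcat a) x :
  hom_fun (unit L M) (hom_fun (rho_bar G M) x) = x.
Proof. by rewrite -hom_fun_cmp rho_bar_section. Qed.

Lemma eval_rho_bar (M : QVcat a) (y : nat -> qv_alg (L M)) t :
  eval (fun i => hom_fun (rho_bar G M) (y i)) t =
  hom_fun (rho_bar G M) (eval y (flex_ext h t)).
Proof. by rewrite -eval_star [RHS]eval_hom_fun. Qed.

Context {P : alg_pair a} {aP : algebraizing_pair P}.
Context {P' : alg_pair a'} {aP' : algebraizing_pair P'}.
Context {I : free_identification L aP aP'} {rho_X : formula a' -> formula a}.
Hypothesis Hrho : is_lifting G I rho_X.

(** The unit undoes [rho_bar], and the identification undoes its own inverse. *)
Lemma cls_flex_ext_lifting t : cls P' (flex_ext h (rho_X t)) = cls P' t.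
Proof.
rewrite -(free_iso_unit I) Hrho /rho_bar_X rho_barK -hom_fun_cmp.
by rewrite iso_invK.
Qed.

Lemma eval_lifting (M : QVcat a) (v : nat -> qv_alg M) :
  exists w : nat -> qv_alg (L M),
    forall t, eval v (rho_X t) = hom_fun (rho_bar G M) (eval w t).
Proof.
have [f fE] := free_hom_exists aP M v.
(* The classes of the variables, carried into [L M] through the identification and [fmap L f]. *)
exists (fun i => hom_fun (fmap L f) (hom_fun (iso_inv I) (cls P' (Var i)))) => t.
rewrite -fE Hrho /rho_bar_X.
set x := hom_fun (iso_inv I) (cls P' t).
have natf : hom_fun (rho_bar G M) (hom_fun (fmap L f) x) =
    hom_fun f (hom_fun (rho_bar G (free_QV aP)) x).
  by have /(congr1 (fun k : hom (star h (L (free_QV aP))) M => hom_fun k x)) :=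
    naturality (rho_bar G) f.
rewrite -natf; congr (hom_fun _ _).
(* As a value at the classes of the variables, [cls P' t] can be pushed through both
   homomorphisms. *)
rewrite /x -(eval_cls_Var _ P' t aP').
by rewrite !eval_hom_fun.
Qed.

Lemma holds_lifting (M : QVcat a) (v : nat -> qv_alg M) :
  exists w : nat -> qv_alg (L M), forall t (e : equation a),
    holds v (subst1 (rho_X t) e.1, subst1 (rho_X t) e.2) <->
    holds w (subst1 t (flex_ext h e.1), subst1 t (flex_ext h e.2)).
Proof.
have [w wE] := eval_lifting M v; exists w => t e.
rewrite /holds /= /subst1 !eval_subst wE !eval_rho_bar.
(* The unit is a left inverse of [rho_bar G M], hence equations are reflected. *)
split=> [|->//] /(congr1 (hom_fun (unit L M))).
by rewrite !rho_barK.
Qed.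

End GlivenkoContext.

Theorem corollary4p7 (a a' : alg_logic) (h : Af_hom a a')
  (L : left_adjoint (star h)) (G : glivenko_context L)
  (P : alg_pair a) (aP : algebraizing_pair P)
  (P' : alg_pair a') (aP' : algebraizing_pair P')
  (I : free_identification L aP aP')
  (rho_X : formula a' -> formula a) (Hrho : is_lifting G I rho_X)
  (Gamma' : set (formula a')) (phi' : formula a') :
  rho_X @` Gamma' ⊢[a] rho_X phi' <-> Gamma' ⊢[a'] phi'.
Proof.
(* For the converse, [a'] is read through [pair_image h P] instead of [P'], to match the equations
   of [holds_lifting]. *)
split=> [/(af_translation h)|/(tau_complete (QV_algebraizes (af_pairs h aP))) H].
  rewrite image_comp.
  apply: (holds_tau_transport _ _ _ (fun t => flex_ext h (rho_X t)) _ _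
    (QV_algebraizes aP')) => M QM v t.
  exact: (cls_eq aP' _ _).1 (cls_flex_ext_lifting G Hrho t) M QM v.
apply/(tau_complete (QV_algebraizes aP)) => M QM v Hv _ [e eP <-].
have [w wE] := holds_lifting G Hrho (QVAlg QM) v.
apply/wE; apply: (H (L (QVAlg QM)) (qv_mem _) w); last first.
  by exists (flex_ext h e.1, flex_ext h e.2) => //; exists e.
move=> _ [t Gt [_ [d dP <-] <-]]; apply/wE; apply: Hv.
by exists (rho_X t); [exists t | exists d].
Qed.
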